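(* Fix $\alpha\in(0,1)$. Let $X_1, X_2,\ldots$ be a sequence of $\{\pm1\}$-valued random variables (a persistent random walk with parameter $\alpha$) such that $\mathrm{Prob}\{X_1=+1\}=\mathrm{Prob}\{X_1=-1\}=\tfrac12$ and, for each $i\ge 2$, conditionally on $X_1,\ldots,X_{i-1}$, $X_i = X_{i-1}$ with probability $\alpha$ and $X_i=-X_{i-1}$ with probability $1-\alpha$. Let $S_0=0$, $S_k=X_1+\cdots+X_k$, and $\Delta_n = \max_{0\le j\le n} S_j - \min_{0\le j\le n} S_j + 1$. Then $$\mathrm{E}(\Delta_n)\sim \sqrt{\frac{8n\alpha}{\pi(1-\alpha)}}\quad\text{as } n\to\infty.$$
   Context: $\Delta_n$ is the number of distinct integer values among $S_0,\ldots,S_n$. *)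

(* Defs.v *)
From Stdlib Require Import Reals ZArith List.
Import ListNotations.
Open Scope R_scope.

(* A path of the walk of length n is a list [X_1; ...; X_n] of signs,
   true = +1, false = -1. *)
Definition step (b : bool) : Z := if b then 1%Z else (-1)%Z.

Fixpoint all_seqs (n : nat) : list (list bool) :=
  match n with
  | O => [nil]
  | S m => flat_map (fun l => [true :: l; false :: l]) (all_seqs m)
  end.

Fixpoint trans_prob (alpha : R) (prev : bool) (t : list bool) : R :=
  match t with
  | nil => 1
  | y :: t' => (if Bool.eqb prev y then alpha else 1 - alpha) * trans_prob alpha y t'
  end.

Definition pers_prob (alpha : R) (l : list bool) : R :=
  match l with
  | nil => 1
  | x :: t => / 2 * trans_prob alpha x t
  end.

(* s = current S_k, mx/mn = max/min of S_0..S_k. *)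
Fixpoint range_aux (s mx mn : Z) (l : list bool) : Z :=
  match l with
  | nil => (mx - mn + 1)%Z
  | x :: t =>
      let s' := (s + step x)%Z in range_aux s' (Z.max mx s') (Z.min mn s') t
  end.

Definition Delta (l : list bool) : Z := range_aux 0 0 0 l.

Definition expected_range (alpha : R) (n : nat) : R :=
  fold_right Rplus 0 (map (fun l => pers_prob alpha l * IZR (Delta l)) (all_seqs n)).

(* Main.v *)
From Stdlib Require Import Reals ZArith List Lra Lia.
From Coquelicot Require Import Coquelicot.
Require Import Defs.
Import ListNotations.
Open Scope R_scope.

(* By symmetry [E Delta_n = 1 + 2 E max S_j], and prepending a step to the walk shows that
   [E Delta_(n+1) - E Delta_n] is the probability [b_n] that, after a down step, the walk
   makes [n] further steps without reaching [+1].  First-step analysis gives the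
   generating function of [b]; with [q = (1 - 2 alpha)^2] it says that
   [2 (1 - alpha) b_n = v_(floor ((n + 1) / 2))] for [n >= 1], where [v] is the coefficient
   sequence of [sqrt (1 - q w) / sqrt (1 - w)].  As the coefficients [e_j] of
   [sqrt (1 - q w)] decay geometrically, while the partial sums
   [U_m = (2 m + 1) C(2m, m) / 4^m] of the coefficients of [1 / sqrt (1 - w)] are
   1-Lipschitz in [m], [v_0 + ... + v_m = sum_j e_j U_(m-j) = U_m sum_j e_j + O(1)].
   Wallis' product gives [U_m ~ 2 sqrt (m / PI)], and
   [sum_j e_j = sqrt (1 - q) = 2 sqrt (alpha (1 - alpha))]. *)

(** * The expected range as a sum of survival probabilities *)

Definition step_prob (alpha : R) (s y : bool) : R :=
  if Bool.eqb s y then alpha else 1 - alpha.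

(** The expectation over the next [n] steps given that the preceding step was [s]. Recursion on the
    first step, with [f] free, makes first-step analysis a mere unfolding. *)
Fixpoint cond_exp (alpha : R) (n : nat) (s : bool) (f : list bool -> R) : R :=
  match n with
  | O => f nil
  | S m =>
      step_prob alpha s true * cond_exp alpha m true (fun l => f (true :: l))
      + step_prob alpha s false * cond_exp alpha m false (fun l => f (false :: l))
  end.

(** A fictitious fair step precedes the path, so that [X_1] obeys the same transition rule as the
    later steps. *)
Definition walk_exp (alpha : R) (n : nat) (f : list bool -> R) : R :=
  / 2 * (cond_exp alpha n true f + cond_exp alpha n false f).

Lemma cond_exp_ext (alpha : R) (n : nat) (s : bool) (f g : list bool -> R) :
  (forall l, f l = g l) -> cond_exp alpha n s f = cond_exp alpha n s g.
Proof.
  revert s f g; induction n as [|n IH]; intros s f g H; simpl; [apply H|].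
  rewrite (IH true _ (fun l => g (true :: l))), (IH false _ (fun l => g (false :: l)));
    intros; auto.
Qed.

Lemma cond_exp_plus (alpha : R) (n : nat) (s : bool) (f g : list bool -> R) :
  cond_exp alpha n s (fun l => f l + g l) = cond_exp alpha n s f + cond_exp alpha n s g.
Proof.
  revert s f g; induction n as [|n IH]; intros s f g; simpl; [reflexivity|].
  rewrite !IH; ring.
Qed.

Lemma cond_exp_const (alpha : R) (n : nat) (s : bool) (c : R) :
  cond_exp alpha n s (fun _ => c) = c.
Proof.
  revert s; induction n as [|n IH]; intros s; simpl; [reflexivity|].
  rewrite !IH; unfold step_prob; destruct s; simpl; ring.
Qed.

(** The transition rule only sees whether consecutive signs agree, so flipping all signs, the
    initial one included, preserves the law. *)
Lemma cond_exp_negb (alpha : R) (n : nat) (s : bool) (f : list bool -> R) :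
  cond_exp alpha n s (fun l => f (map negb l)) = cond_exp alpha n (negb s) f.
Proof.
  revert s f; induction n as [|n IH]; intros s f; simpl; [reflexivity|].
  rewrite (IH true (fun l => f (false :: l))), (IH false (fun l => f (true :: l))).
  unfold step_prob; destruct s; simpl; ring.
Qed.

Lemma sum_flat_map_cons (g : list bool -> R) (L : list (list bool)) :
  fold_right Rplus 0 (map g (flat_map (fun l => [true :: l; false :: l]) L)) =
  fold_right Rplus 0 (map (fun l => g (true :: l)) L)
  + fold_right Rplus 0 (map (fun l => g (false :: l)) L).
Proof. induction L as [|l L IH]; simpl; [ring|rewrite IH; ring]. Qed.

Lemma sum_scal (c : R) (g : list bool -> R) (L : list (list bool)) :
  fold_right Rplus 0 (map (fun l => c * g l) L) = c * fold_right Rplus 0 (map g L).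
Proof. induction L as [|l L IH]; simpl; [ring|rewrite IH; ring]. Qed.

Lemma sum_trans_prob (alpha : R) (n : nat) (s : bool) (f : list bool -> R) :
  fold_right Rplus 0 (map (fun l => trans_prob alpha s l * f l) (all_seqs n)) =
  cond_exp alpha n s f.
Proof.
  revert s f; induction n as [|n IH]; intros s f; simpl; [ring|].
  rewrite sum_flat_map_cons; simpl.
  rewrite <- !IH, <- !sum_scal; f_equal; f_equal; apply map_ext; intros l;
    unfold step_prob; ring.
Qed.

(* Each of the two transition laws averages to a fair first step. *)
Lemma sum_pers_prob (alpha : R) (n : nat) (f : list bool -> R) :
  fold_right Rplus 0 (map (fun l => pers_prob alpha l * f l) (all_seqs n)) =
  walk_exp alpha n f.
Proof.
  unfold walk_exp; destruct n as [|n]; simpl; [field|].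
  rewrite sum_flat_map_cons; simpl.
  rewrite (map_ext _ (fun l => / 2 * (trans_prob alpha true l * f (true :: l))))
    by (intros; ring).
  rewrite (map_ext (fun l => / 2 * trans_prob alpha false l * f (false :: l))
             (fun l => / 2 * (trans_prob alpha false l * f (false :: l))))
    by (intros; ring).
  rewrite !sum_scal, (sum_trans_prob _ _ _ (fun l => f (true :: l))),
    (sum_trans_prob _ _ _ (fun l => f (false :: l))).
  unfold step_prob; simpl; field.
Qed.

(** * Reduction of the range to the one-sided maximum *)

Fixpoint walk_max (l : list bool) : Z :=
  match l with
  | nil => 0%Z
  | x :: t => Z.max 0 (step x + walk_max t)
  end.

Lemma walk_max_ge0 (l : list bool) : (0 <= walk_max l)%Z.
Proof. destruct l; simpl; lia. Qed.

(** The depth reached below the start is the maximum of the reflected path. General accumulators are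
    needed for the induction on the path. *)
Lemma range_aux_walk_max (l : list bool) (s mx mn : Z) :
  (mn <= s <= mx)%Z ->
  range_aux s mx mn l =
  (Z.max mx (s + walk_max l) - Z.min mn (s - walk_max (map negb l)) + 1)%Z.
Proof.
  revert s mx mn; induction l as [|x l IH]; intros s mx mn H;
    cbn [range_aux walk_max map]; [lia|].
  pose proof (walk_max_ge0 l); pose proof (walk_max_ge0 (map negb l)).
  destruct x; cbn [step negb]; rewrite IH; lia.
Qed.

Lemma Delta_walk_max (l : list bool) :
  Delta l = (walk_max l + walk_max (map negb l) + 1)%Z.
Proof.
  unfold Delta; rewrite range_aux_walk_max by lia.
  pose proof (walk_max_ge0 l); pose proof (walk_max_ge0 (map negb l)); lia.
Qed.

Lemma expected_range_max (alpha : R) (n : nat) :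
  expected_range alpha n = 1 + 2 * walk_exp alpha n (fun l => IZR (walk_max l)).
Proof.
  unfold expected_range; rewrite (sum_pers_prob _ _ (fun l => IZR (Delta l))).
  unfold walk_exp.
  assert (H : forall s, cond_exp alpha n s (fun l => IZR (Delta l)) =
    cond_exp alpha n s (fun l => IZR (walk_max l))
    + cond_exp alpha n (negb s) (fun l => IZR (walk_max l)) + 1).
  { intros s; rewrite <- (cond_exp_negb _ _ _ (fun l => IZR (walk_max l))).
    rewrite <- cond_exp_plus, <- (cond_exp_const alpha n s 1) at 1.
    rewrite <- cond_exp_plus; apply cond_exp_ext; intros l.
    rewrite Delta_walk_max, !plus_IZR; ring. }
  rewrite !H; simpl; field.
Qed.

(* [stay alpha n s k] is the probability that the walk, after a step [s], spends its
   next [n] steps at height at most [k]. *)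
Fixpoint stay (alpha : R) (n : nat) (s : bool) (k : nat) : R :=
  match n with
  | O => 1
  | S m =>
      step_prob alpha s true * match k with O => 0 | S j => stay alpha m true j end
      + step_prob alpha s false * stay alpha m false (S k)
  end.

(** The ceiling [k] is measured from the current position: an up step lowers it by one, and is fatal
    at 0, while a down step raises it by one. *)
Lemma cond_exp_stay (alpha : R) (n : nat) (s : bool) (k : nat) :
  cond_exp alpha n s (fun l => if (walk_max l <=? Z.of_nat k)%Z then 1 else 0) =
  stay alpha n s k.
Proof.
  revert s k; induction n as [|n IH]; intros s k.
  - simpl; destruct k; reflexivity.
  - cbn [cond_exp stay]; f_equal; f_equal.
    + destruct k as [|k].
      * transitivity (cond_exp alpha n true (fun _ => 0)); [|apply cond_exp_const].
        apply cond_exp_ext; intros l.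
        pose proof (walk_max_ge0 l).
        replace (_ <=? _)%Z with false; [reflexivity|].
        symmetry; apply Z.leb_gt; cbn [walk_max step]; lia.
      * rewrite <- IH; apply cond_exp_ext; intros l.
        replace (walk_max (true :: l) <=? Z.of_nat (S k))%Z
          with (walk_max l <=? Z.of_nat k)%Z; [reflexivity|].
        pose proof (walk_max_ge0 l).
        apply Bool.eq_iff_eq_true; rewrite !Z.leb_le; cbn [walk_max step]; lia.
    + rewrite <- IH; apply cond_exp_ext; intros l.
      replace (walk_max (false :: l) <=? Z.of_nat k)%Z
        with (walk_max l <=? Z.of_nat (S k))%Z; [reflexivity|].
      apply Bool.eq_iff_eq_true; rewrite !Z.leb_le; cbn [walk_max step]; lia.
Qed.

(* Prepending a step [x] changes the maximum [M] into [x + M], except that [-1 + 0]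
   becomes [0]; the steps cancel on average. *)
Lemma walk_exp_max_succ (alpha : R) (n : nat) :
  2 * walk_exp alpha (S n) (fun l => IZR (walk_max l)) =
  2 * walk_exp alpha n (fun l => IZR (walk_max l)) + stay alpha n false 0.
Proof.
  unfold walk_exp; rewrite <- cond_exp_stay; cbn [cond_exp].
  rewrite (cond_exp_ext _ _ true _ (fun l => IZR (walk_max l) + 1)).
  2: { intros l; pose proof (walk_max_ge0 l); cbn [walk_max step].
       rewrite Z.max_r, plus_IZR by lia; ring. }
  rewrite (cond_exp_ext _ _ false (fun l => IZR (walk_max (false :: l)))
    (fun l => (IZR (walk_max l) + -1)
              + if (walk_max l <=? Z.of_nat 0)%Z then 1 else 0)).
  2: { intros l; pose proof (walk_max_ge0 l); cbn [walk_max step].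
       destruct (Z.leb_spec (walk_max l) (Z.of_nat 0)).
       - replace (walk_max l) with 0%Z by lia.
         change (Z.max 0 (-1 + 0)) with 0%Z; ring.
       - rewrite Z.max_r, plus_IZR by lia; ring. }
  rewrite !cond_exp_plus, !cond_exp_const; unfold step_prob; simpl; field.
Qed.

Lemma expected_range_succ (alpha : R) (n : nat) :
  expected_range alpha (S n) = expected_range alpha n + stay alpha n false 0.
Proof. rewrite !expected_range_max, walk_exp_max_succ; ring. Qed.

Lemma expected_range_0 (alpha : R) : expected_range alpha 0 = 1.
Proof. unfold expected_range; simpl; change (Delta nil) with 1%Z; ring. Qed.

(** * Generating function of the survival probabilities *)

Lemma step_prob_ge0 (alpha : R) (s y : bool) :
  0 < alpha < 1 -> 0 <= step_prob alpha s y.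
Proof. unfold step_prob; destruct (Bool.eqb s y); lra. Qed.

Lemma step_prob_sum (alpha : R) (s : bool) :
  step_prob alpha s true + step_prob alpha s false = 1.
Proof. unfold step_prob; destruct s; simpl; ring. Qed.

Lemma stay_bound (alpha : R) (n : nat) (s : bool) (k : nat) :
  0 < alpha < 1 -> 0 <= stay alpha n s k <= 1.
Proof.
  intros Ha; revert s k; induction n as [|n IH]; intros s k; simpl; [lra|].
  pose proof (step_prob_ge0 alpha s true Ha).
  pose proof (step_prob_ge0 alpha s false Ha).
  pose proof (step_prob_sum alpha s).
  pose proof (IH false (S k)).
  assert (0 <= match k with O => 0 | S j => stay alpha n true j end <= 1)
    by (destruct k; [lra|apply IH]).
  nra.
Qed.

(** First-step analysis on truncated generating functions: the factor [z] accounts for one step, so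
    the truncation degree drops by one and no convergence is involved. *)
Lemma sum_stay_succ (alpha z : R) (N : nat) (s : bool) (k : nat) :
  sum_f_R0 (fun n => stay alpha n s k * z ^ n) (S N) =
  1 + z * (step_prob alpha s true * match k with
             | O => 0
             | S j => sum_f_R0 (fun n => stay alpha n true j * z ^ n) N
             end
           + step_prob alpha s false
             * sum_f_R0 (fun n => stay alpha n false (S k) * z ^ n) N).
Proof.
  induction N as [|N IH].
  - destruct k; simpl; ring.
  - rewrite tech5, IH, !tech5; destruct k; [|rewrite tech5]; cbn [stay pow]; ring.
Qed.

(* The partial sums of the generating functions are the iterates, started from [1], of a
   [|z|]-contraction, so they converge to any bounded fixed point of it. *)
Lemma stay_gf (alpha z K : R) (C : bool -> nat -> R) (s : bool) (k : nat) :
  0 < alpha < 1 -> Rabs z < 1 ->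
  (forall s k, Rabs (1 - C s k) <= K) ->
  (forall s k, C s k =
     1 + z * (step_prob alpha s true * match k with O => 0 | S j => C true j end
              + step_prob alpha s false * C false (S k))) ->
  is_pseries (fun n => stay alpha n s k) z (C s k).
Proof.
  intros Ha Hz HK HC.
  assert (HK0 : 0 <= K) by (eapply Rle_trans; [apply Rabs_pos|apply (HK true O)]).
  assert (B : forall N s k,
    Rabs (sum_f_R0 (fun n => stay alpha n s k * z ^ n) N - C s k) <= K * Rabs z ^ N).
  { induction N as [|N IH]; intros s' k'.
    - simpl; rewrite !Rmult_1_r; apply HK.
    - rewrite sum_stay_succ, HC.
      set (p := step_prob alpha s' true); set (q := step_prob alpha s' false).
      set (x := match k' with O => 0 | S j => sum_f_R0 _ N end).
      set (x0 := match k' with O => 0 | S j => C true j end).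
      set (y := sum_f_R0 _ N); set (y0 := C false (S k')).
      assert (Hx : Rabs (x - x0) <= K * Rabs z ^ N).
      { unfold x, x0; destruct k'; [|apply IH].
        rewrite Rminus_0_r, Rabs_R0; apply Rmult_le_pos; [exact HK0|].
        apply pow_le, Rabs_pos. }
      assert (Hy : Rabs (y - y0) <= K * Rabs z ^ N) by apply IH.
      assert (Hp : 0 <= p) by (apply step_prob_ge0; exact Ha).
      assert (Hq : 0 <= q) by (apply step_prob_ge0; exact Ha).
      assert (Hpq : p + q = 1) by apply step_prob_sum.
      (* As [p + q = 1], averaging the two errors keeps their common bound, and the factor [z]
         contracts it. *)
      replace (1 + z * (p * x + q * y) - (1 + z * (p * x0 + q * y0)))
        with (z * (p * (x - x0) + q * (y - y0))) by ring.
      rewrite Rabs_mult; simpl.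
      replace (K * (Rabs z * Rabs z ^ N)) with (Rabs z * (K * Rabs z ^ N)) by ring.
      apply Rmult_le_compat_l; [apply Rabs_pos|].
      eapply Rle_trans; [apply Rabs_triang|].
      rewrite !Rabs_mult, (Rabs_pos_eq p), (Rabs_pos_eq q) by assumption.
      replace (K * Rabs z ^ N) with (p * (K * Rabs z ^ N) + q * (K * Rabs z ^ N))
        by (replace q with (1 - p) by lra; ring).
      apply Rplus_le_compat; apply Rmult_le_compat_l; assumption. }
  apply is_pseries_R.
  apply (is_lim_seq_ext (fun N => C s k
    + (sum_f_R0 (fun n => stay alpha n s k * z ^ n) N - C s k)) _ (C s k)).
  { intros N; rewrite sum_n_Reals; ring. }
  replace (Finite (C s k)) with (Finite (C s k + 0)) by (f_equal; ring).
  apply is_lim_seq_plus'; [apply is_lim_seq_const|].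
  apply is_lim_seq_abs_0.
  apply (is_lim_seq_le_le (fun _ => 0) _ (fun N => K * Rabs z ^ N)).
  - intros N; split; [apply Rabs_pos|apply B].
  - apply is_lim_seq_const.
  - replace (Finite 0) with (Rbar_mult K 0) by (simpl; f_equal; ring).
    apply is_lim_seq_scal_l, is_lim_seq_geom; rewrite Rabs_Rabsolu; exact Hz.
Qed.

(** The survival series is [(1 - Fm) / (1 - z)], where [Fm] is the generating function of a hitting
    time. Giving [A] and [B] by their squares keeps the verification algebraic. *)
Lemma stay0_gf (alpha z A B : R) :
  0 < alpha < 1 -> Rabs z < 1 -> 0 < A -> 0 < B ->
  A * A = 1 - z * z -> B * B = 1 - (1 - 2 * alpha) ^ 2 * (z * z) ->
  is_pseries (fun n => stay alpha n false 0) z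
    ((1 - 2 * z * (1 - alpha) / (1 + (1 - 2 * alpha) * z * z + A * B)) / (1 - z)).
Proof.
  intros Ha Hz HA HB EA EB.
  set (D := 1 + (1 - 2 * alpha) * z * z + A * B).
  set (D' := 1 - (1 - 2 * alpha) * z * z + A * B).
  (* [Fm], [Fp] are the generating functions of the hitting time of [+1] after a down,
     resp. up, step: the solution with [|Fp| <= 1] of the system [HF]. *)
  set (Fm := 2 * z * (1 - alpha) / D).
  set (Fp := 2 * z * alpha / D').
  assert (Hz' : -1 < z < 1) by (apply Rabs_def2 in Hz; lra).
  assert (Hzz : 0 <= z * z < 1) by nra.
  assert (HAB : 0 < A * B) by nra.
  assert (HD : 0 < D) by (unfold D; nra).
  assert (HD' : 0 < D') by (unfold D'; nra).
  set (F := fun s : bool => if s then Fp else Fm).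
  assert (HF : forall s, F s = z * (step_prob alpha s true
                                    + step_prob alpha s false * (Fm * Fp))).
  { assert (E1 : A * B * (A * B) = (1 - z * z) * (1 - (1 - 2 * alpha) ^ 2 * (z * z)))
      by (rewrite <- EA, <- EB; ring).
    (* [D * (2 - D')] and [D' * (2 - D)] are differences of squares; by [E1] they equal
       [4 z^2 (1 - alpha)^2] and [4 z^2 alpha^2]. *)
    assert (E2 : D' = 2 - 4 * z * z * (1 - alpha) * (1 - alpha) / D)
      by (apply (Rmult_eq_reg_r D); [|lra]; field_simplify; [unfold D, D'; nra|lra]).
    assert (E3 : D = 2 - 4 * z * z * alpha * alpha / D')
      by (apply (Rmult_eq_reg_r D'); [|lra]; field_simplify; [unfold D, D'; nra|lra]).
    intros [|]; unfold F, Fm, Fp, step_prob; simpl.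
    - apply (Rmult_eq_reg_r D'); [|lra].
      transitivity (z * alpha * 2); [field; lra|].
      transitivity (z * alpha * (D' + 4 * z * z * (1 - alpha) * (1 - alpha) / D));
        [rewrite E2; ring|field; lra].
    - apply (Rmult_eq_reg_r D); [|lra].
      transitivity (z * (1 - alpha) * 2); [field; lra|].
      transitivity (z * (1 - alpha) * (D + 4 * z * z * alpha * alpha / D'));
        [rewrite E3 at 1; ring|field; lra]. }
  (* This bound makes the fixed point below bounded uniformly in [k], as [stay_gf] requires. *)
  assert (HFp : Rabs Fp <= 1).
  { unfold Fp, Rdiv; rewrite Rabs_mult, (Rabs_pos_eq (/ D'))
      by (left; apply Rinv_0_lt_compat; exact HD').
    apply (Rmult_le_reg_r D'); [exact HD'|].
    rewrite Rmult_assoc, Rinv_l, Rmult_1_r, Rmult_1_l by lra.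
    apply Rabs_le; unfold D'; split; nra. }
  assert (HFpk : forall k, Rabs (Fp ^ k) <= 1).
  { intros k; rewrite <- RPow_abs, <- (pow1 k); apply pow_incr.
    split; [apply Rabs_pos|exact HFp]. }
  (* To exceed height [k] after a step [s], the walk first reaches [+1], then climbs [k] more
     levels, each time starting after an up step; hence the factor [F s * Fp ^ k]. *)
  replace ((1 - Fm) / (1 - z)) with ((fun s k => (1 - F s * Fp ^ k) / (1 - z)) false O)
    by (simpl; f_equal; ring).
  apply (stay_gf alpha z (1 + (1 + (Rabs Fm + Rabs Fp)) / (1 - z))
           (fun s k => (1 - F s * Fp ^ k) / (1 - z))); try assumption.
  - intros s k; eapply Rle_trans; [apply Rabs_triang|].
    rewrite Rabs_R1, Rabs_Ropp; apply Rplus_le_compat_l.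
    unfold Rdiv; rewrite Rabs_mult, (Rabs_pos_eq (/ (1 - z)))
      by (left; apply Rinv_0_lt_compat; lra).
    apply Rmult_le_compat_r; [left; apply Rinv_0_lt_compat; lra|].
    eapply Rle_trans; [apply Rabs_triang|].
    rewrite Rabs_R1, Rabs_Ropp, Rabs_mult; apply Rplus_le_compat_l.
    pose proof (Rabs_pos Fm); pose proof (Rabs_pos Fp); pose proof (HFpk k).
    pose proof (Rabs_pos (Fp ^ k)).
    destruct s; simpl; nra.
  - intros s k; rewrite HF at 1; pose proof (step_prob_sum alpha s) as E.
    replace (step_prob alpha s false) with (1 - step_prob alpha s true) by lra.
    destruct k; simpl; field; lra.
Qed.

(** * The coefficients of (1 - x)^(-1/2) and (1 - x)^(1/2) *)

Lemma CV_radius_ge_1 (a : nat -> R) (M : R) :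
  (forall n, Rabs (a n) <= M) -> Rbar_le 1 (CV_radius a).
Proof.
  intros H; apply (proj1 (CV_radius_bounded a)).
  exists M; intros n; rewrite pow1, Rmult_1_r; apply H.
Qed.

Lemma CV_radius_gt_abs (a : nat -> R) (M x : R) :
  (forall n, Rabs (a n) <= M) -> Rabs x < 1 -> Rbar_lt (Rabs x) (CV_radius a).
Proof.
  intros H Hx; apply (Rbar_lt_le_trans _ 1); [exact Hx|].
  exact (CV_radius_ge_1 a M H).
Qed.

(* [binom_half n] is [C(2n, n) / 4 ^ n]. *)
Fixpoint binom_half (n : nat) : R :=
  match n with
  | O => 1
  | S m => binom_half m * ((2 * INR m + 1) / (2 * INR m + 2))
  end.

Lemma binom_half_pos (n : nat) : 0 < binom_half n.
Proof.
  induction n as [|n IH]; simpl; [lra|].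
  pose proof (pos_INR n).
  apply Rmult_lt_0_compat; [exact IH|apply Rdiv_lt_0_compat; lra].
Qed.

Lemma binom_half_succ_le (n : nat) : binom_half (S n) <= binom_half n.
Proof.
  simpl; pose proof (pos_INR n); pose proof (binom_half_pos n).
  rewrite <- (Rmult_1_r (binom_half n)) at 2.
  apply Rmult_le_compat_l; [lra|].
  apply Rle_div_l; lra.
Qed.

Lemma binom_half_le1 (n : nat) : binom_half n <= 1.
Proof.
  induction n as [|n IH]; [simpl; lra|].
  eapply Rle_trans; [apply binom_half_succ_le|exact IH].
Qed.

Lemma binom_half_abs (n : nat) : Rabs (binom_half n) <= 1.
Proof.
  rewrite Rabs_pos_eq by (left; apply binom_half_pos); apply binom_half_le1.
Qed.

(** These are the coefficients of [(1 - x)^(-3/2)]; the closed form lets Wallis' product estimate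
    the partial sums. *)
Lemma sum_binom_half (n : nat) :
  sum_f_R0 binom_half n = (2 * INR n + 1) * binom_half n.
Proof.
  induction n as [|n IH]; [simpl; ring|].
  rewrite tech5, IH, S_INR; simpl; pose proof (pos_INR n); field; lra.
Qed.

(** Needed to choose the sign when the square of the series is known. *)
Lemma PSeries_binom_half_ge0 (x : R) :
  0 <= x < 1 -> 0 <= PSeries binom_half x.
Proof.
  intros Hx.
  assert (Hc : ex_pseries binom_half x).
  { apply CV_radius_inside, (CV_radius_gt_abs _ 1); [apply binom_half_abs|].
    rewrite Rabs_pos_eq; lra. }
  apply PSeries_correct, is_pseries_R in Hc.
  apply (is_lim_seq_le (fun _ => 0) (sum_n (fun n => binom_half n * x ^ n)) 0
           (PSeries binom_half x)); [|apply is_lim_seq_const|exact Hc].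
  intros n; rewrite sum_n_Reals; apply cond_pos_sum; intros k.
  apply Rmult_le_pos; [left; apply binom_half_pos|apply pow_le; lra].
Qed.

(* The recursion of the coefficients is the equation [2 (1 - x) y' = y], whence
   [(1 - x) y ^ 2] is constant. *)
Lemma PSeries_binom_half_sqr (x : R) :
  0 <= x < 1 -> (1 - x) * PSeries binom_half x ^ 2 = 1.
Proof.
  intros Hx.
  assert (Hr : forall t, 0 <= t < 1 -> Rbar_lt (Rabs t) (CV_radius binom_half)).
  { intros t Ht; apply (CV_radius_gt_abs _ 1); [apply binom_half_abs|].
    rewrite Rabs_pos_eq; lra. }
  assert (Hode : forall t, 0 <= t < 1 ->
    (1 - t) * PSeries (PS_derive binom_half) t = / 2 * PSeries binom_half t).
  { intros t Ht.
    assert (Hc : ex_pseries binom_half t) by (apply CV_radius_inside, Hr, Ht).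
    assert (Hd : ex_pseries (PS_derive binom_half) t)
      by (apply CV_radius_inside; rewrite CV_radius_derive; apply Hr, Ht).
    (* Coefficientwise, [(n + 1) u_(n+1) = n u_n + u_n / 2], that is, [y' = x y' + y / 2]. *)
    assert (E : PSeries (PS_derive binom_half) t =
      PSeries (PS_plus (PS_incr_1 (PS_derive binom_half)) (PS_scal (/ 2) binom_half)) t).
    { apply PSeries_ext; intros [|n]; unfold PS_plus, PS_incr_1, PS_scal, PS_derive;
        cbn -[INR].
      - simpl; unfold zero; simpl; field.
      - rewrite !S_INR; pose proof (pos_INR n).
        unfold plus, scal; simpl; unfold mult; simpl; field; lra. }
    rewrite PSeries_plus in E.
    - rewrite PSeries_incr_1, PSeries_scal in E; lra.
    - apply ex_pseries_incr_1; exact Hd.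
    - apply ex_pseries_scal; [apply Rmult_comm|exact Hc]. }
  (* The constancy argument below needs a nondegenerate interval from 0 to [x]. *)
  destruct (Req_dec x 0) as [->|Hx0].
  { rewrite PSeries_0; simpl; ring. }
  transitivity ((fun t => (1 - t) * PSeries binom_half t ^ 2) 0).
  2: { rewrite PSeries_0; simpl; ring. }
  symmetry; apply (eq_is_derive (fun t => (1 - t) * PSeries binom_half t ^ 2)); [|lra].
  intros t Ht.
  pose proof (is_derive_PSeries binom_half t (Hr t ltac:(lra))) as Hd.
  pose proof (Hode t ltac:(lra)) as Ho.
  auto_derive.
  - eexists; exact Hd.
  - replace (Derive (fun x0 : R => PSeries binom_half x0) t)
      with (PSeries (PS_derive binom_half) t)
      by (symmetry; apply is_derive_unique; exact Hd).
    unfold zero; simpl; nra.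
Qed.

Lemma PSeries_binom_half (x : R) :
  0 <= x < 1 -> PSeries binom_half x = / sqrt (1 - x).
Proof.
  intros Hx.
  pose proof (PSeries_binom_half_sqr x Hx) as H.
  pose proof (PSeries_binom_half_ge0 x Hx) as H0.
  rewrite <- sqrt_inv.
  rewrite <- (sqrt_pow2 (PSeries binom_half x)) by exact H0.
  f_equal; apply (Rmult_eq_reg_l (1 - x)); [|lra].
  rewrite H, Rinv_r; lra.
Qed.

(** The coefficients of [(1 - x)^(1/2)], obtained as [(1 - x)] times [(1 - x)^(-1/2)], hence the
    differences. *)
Definition sqrt_coef (n : nat) : R :=
  match n with
  | O => 1
  | S m => binom_half (S m) - binom_half m
  end.

Lemma sqrt_coef_abs (n : nat) : Rabs (sqrt_coef n) <= 1.
Proof.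
  destruct n as [|n]; unfold sqrt_coef; [rewrite Rabs_R1; lra|].
  pose proof (binom_half_succ_le n); pose proof (binom_half_pos (S n)).
  pose proof (binom_half_le1 n).
  apply Rabs_le; lra.
Qed.

Lemma is_pseries_sqrt_coef (x : R) :
  0 <= x < 1 -> is_pseries sqrt_coef x (sqrt (1 - x)).
Proof.
  intros Hx.
  assert (Hc : ex_pseries binom_half x).
  { apply CV_radius_inside, (CV_radius_gt_abs _ 1); [apply binom_half_abs|].
    rewrite Rabs_pos_eq; lra. }
  apply PSeries_correct in Hc; rewrite PSeries_binom_half in Hc by exact Hx.
  pose proof (is_pseries_minus _ _ _ _ _ Hc (is_pseries_incr_1 _ _ _ Hc)) as H.
  replace (plus _ _) with (sqrt (1 - x)) in H.
  - eapply is_pseries_ext; [|exact H]; intros [|n];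
      unfold PS_minus, PS_plus, PS_opp, PS_incr_1, plus, opp, zero; simpl; ring.
  - unfold plus, opp, scal; simpl; unfold mult; simpl.
    assert (0 < sqrt (1 - x)) by (apply sqrt_lt_R0; lra).
    apply (Rmult_eq_reg_r (sqrt (1 - x))); [|lra].
    rewrite sqrt_sqrt by lra; field; lra.
Qed.

(** * Partial sums of Cauchy products *)

Lemma sum_INR_pow_le (q : R) (m : nat) :
  0 <= q < 1 -> sum_f_R0 (fun j => INR j * q ^ j) m <= / (1 - q) ^ 2.
Proof.
  intros Hq.
  assert (E : (1 - q) ^ 2 * sum_f_R0 (fun j => INR j * q ^ j) m =
    q - (INR m + 1) * q ^ S m + INR m * q ^ S (S m)).
  { induction m as [|m IH]; [simpl; ring|].
    rewrite tech5, Rmult_plus_distr_l, IH, S_INR; simpl; ring. }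
  apply (Rmult_le_reg_l ((1 - q) ^ 2)); [apply pow_lt; lra|].
  rewrite E, Rinv_r by (apply pow_nonzero; lra).
  pose proof (pow_le q (S m) ltac:(lra)); pose proof (pos_INR m).
  replace (q ^ S (S m)) with (q * q ^ S m) by (simpl; ring).
  assert (INR m * (q * q ^ S m) <= INR m * (1 * q ^ S m))
    by (apply Rmult_le_compat_l; [assumption|apply Rmult_le_compat_r; lra]).
  nra.
Qed.

(** Summation over the triangle [i + j <= m], by diagonals on one side and by rows on the other. *)
Lemma sum_PS_mult (e u : nat -> R) (m : nat) :
  sum_f_R0 (PS_mult e u) m = sum_f_R0 (fun j => e j * sum_f_R0 u (m - j)) m.
Proof.
  induction m as [|m IH]; [reflexivity|].
  rewrite tech5, IH; unfold PS_mult; rewrite !tech5, Nat.sub_diag; simpl.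
  rewrite <- Rplus_assoc, <- plus_sum; f_equal.
  apply sum_eq; intros i Hi.
  replace (S m - i)%nat with (S (m - i)) by lia.
  change (match i with O => S m | S l => (m - l)%nat end) with (S m - i)%nat.
  replace (S m - i)%nat with (S (m - i)) by lia.
  rewrite tech5; ring.
Qed.

Lemma sum_binom_half_lipschitz (m j : nat) : (j <= m)%nat ->
  0 <= sum_f_R0 binom_half m - sum_f_R0 binom_half (m - j) <= INR j.
Proof.
  induction j as [|j IH]; intros Hj.
  - rewrite Nat.sub_0_r; simpl; lra.
  - specialize (IH ltac:(lia)).
    replace (m - j)%nat with (S (m - S j)) in IH by lia.
    rewrite tech5 in IH; rewrite S_INR.
    pose proof (binom_half_pos (S (m - S j))).
    pose proof (binom_half_le1 (S (m - S j))); lra.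
Qed.

(** The difference is [sum_j e_j (U_(m-j) - U_m)], where [U] denotes the partial sums of
    [binom_half]; the Lipschitz bound reduces it to [sum_j j q^j]. *)
Lemma sum_PS_mult_binom_half (q : R) (e : nat -> R) (m : nat) :
  0 <= q < 1 -> (forall j, Rabs (e j) <= q ^ j) ->
  Rabs (sum_f_R0 (PS_mult e binom_half) m - sum_f_R0 e m * sum_f_R0 binom_half m)
  <= / (1 - q) ^ 2.
Proof.
  intros Hq He; rewrite sum_PS_mult.
  rewrite Rmult_comm, scal_sum, <- minus_sum.
  eapply Rle_trans; [apply Rabs_triang_gen|].
  eapply Rle_trans; [|apply (sum_INR_pow_le q m Hq)].
  apply sum_Rle; intros j Hj.
  rewrite <- Rmult_minus_distr_l, Rabs_mult, Rabs_minus_sym, Rmult_comm.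
  pose proof (sum_binom_half_lipschitz m j Hj).
  apply Rmult_le_compat; try apply Rabs_pos; [|apply He].
  rewrite Rabs_pos_eq; lra.
Qed.

(** * Wallis integrals and the size of [binom_half] *)

Definition wallis (n : nat) : R := RInt (fun x => sin x ^ n) 0 (PI / 2).

Lemma ex_RInt_sin_pow (n : nat) (a b : R) : ex_RInt (fun x => sin x ^ n) a b.
Proof.
  apply (ex_RInt_continuous (V := R_CompleteNormedModule)); intros x _.
  apply (ex_derive_continuous (fun x => sin x ^ n)).
  auto_derive; exact I.
Qed.

Lemma wallis_succ_le (n : nat) : wallis (S n) <= wallis n.
Proof.
  unfold wallis; apply RInt_le; try apply ex_RInt_sin_pow; [pose proof PI_RGT_0; lra|].
  intros x Hx; simpl; rewrite <- (Rmult_1_l (sin x ^ n)) at 2.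
  apply Rmult_le_compat_r; [apply pow_le, sin_ge_0; lra|apply SIN_bound].
Qed.

(** Integration by parts, phrased as the fundamental theorem for [- cos x * sin x ^ S n], which
    vanishes at both endpoints. *)
Lemma wallis_rec (n : nat) : (INR n + 2) * wallis (S (S n)) = (INR n + 1) * wallis n.
Proof.
  assert (H : is_RInt
    (fun x => (INR n + 2) * sin x ^ S (S n) - (INR n + 1) * sin x ^ n) 0 (PI / 2)
    (minus ((fun x => - cos x * sin x ^ S n) (PI / 2))
       ((fun x => - cos x * sin x ^ S n) 0))).
  { apply (is_RInt_derive (V := R_CompleteNormedModule) (fun x => - cos x * sin x ^ S n));
      intros x _.
    - auto_derive; [exact I|].
      change (pred (S n)) with n; pose proof (sin2_cos2 x) as E; unfold Rsqr in E.
      change (match n with O => 1 | S _ => INR n + 1 end) with (INR (S n)).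
      rewrite ?S_INR; simpl.
      replace (cos x * cos x) with (1 - sin x * sin x) by lra.
      transitivity (sin x * (sin x * sin x ^ n)
        - (INR n + 1) * (cos x * cos x) * sin x ^ n); [ring|].
      replace (cos x * cos x) with (1 - sin x * sin x) by lra; ring.
    - apply (ex_derive_continuous
        (fun x => (INR n + 2) * sin x ^ S (S n) - (INR n + 1) * sin x ^ n)).
      auto_derive; exact I. }
  assert (H' : is_RInt
    (fun x => (INR n + 2) * sin x ^ S (S n) - (INR n + 1) * sin x ^ n) 0 (PI / 2)
    ((INR n + 2) * wallis (S (S n)) - (INR n + 1) * wallis n)).
  { apply (is_RInt_minus (V := R_NormedModule)
      (fun x => (INR n + 2) * sin x ^ S (S n)) (fun x => (INR n + 1) * sin x ^ n));
      apply (is_RInt_scal (V := R_NormedModule));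
      apply (RInt_correct (V := R_CompleteNormedModule)), ex_RInt_sin_pow. }
  apply (is_RInt_unique (V := R_CompleteNormedModule)) in H, H'.
  rewrite H in H'; rewrite cos_PI2, sin_0 in H'.
  unfold minus, plus, opp in H'; simpl in H'; simpl; lra.
Qed.

Lemma wallis_even (m : nat) : wallis (2 * m) = binom_half m * (PI / 2).
Proof.
  induction m as [|m IH].
  - unfold wallis; simpl; rewrite RInt_const; unfold scal; simpl; unfold mult; simpl; ring.
  - replace (2 * S m)%nat with (S (S (2 * m))) by lia.
    pose proof (wallis_rec (2 * m)) as H; rewrite IH, mult_INR in H; change (INR 2) with 2 in H.
    pose proof (pos_INR m); simpl binom_half.
    apply (Rmult_eq_reg_l (2 * INR m + 2)); [|lra].
    rewrite H; field; lra.
Qed.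

Lemma wallis_odd (m : nat) : wallis (2 * m + 1) = / ((2 * INR m + 1) * binom_half m).
Proof.
  induction m as [|m IH].
  - assert (H : is_RInt (fun x => sin x ^ 1) 0 (PI / 2)
      (minus ((fun x => - cos x) (PI / 2)) ((fun x => - cos x) 0))).
    { apply (is_RInt_derive (V := R_CompleteNormedModule) (fun x => - cos x));
        intros x _.
      - auto_derive; [exact I|ring].
      - apply (ex_derive_continuous (fun x => sin x ^ 1)); auto_derive; exact I. }
    apply (is_RInt_unique (V := R_CompleteNormedModule)) in H; unfold wallis; simpl in *.
    rewrite H, cos_PI2, cos_0; unfold minus, plus, opp; simpl; field.
  - replace (2 * S m + 1)%nat with (S (S (2 * m + 1))) by lia.
    pose proof (wallis_rec (2 * m + 1)) as H.
    rewrite IH, plus_INR, mult_INR in H; change (INR 2) with 2 in H; change (INR 1) with 1 in H.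
    pose proof (pos_INR m); pose proof (binom_half_pos m); rewrite S_INR; simpl binom_half.
    apply (Rmult_eq_reg_l (2 * INR m + 1 + 2)); [|lra].
    rewrite H; field; lra.
Qed.

(** Rescaled form of [wallis (2 m + 2) <= wallis (2 m + 1) <= wallis (2 m)]: the right inequality
    gives the lower bound, the left one the upper bound. *)
Lemma binom_half_sqr_bounds (m : nat) :
  2 / PI <= (2 * INR m + 1) * binom_half m ^ 2 <= 2 / PI * (1 + / (2 * INR m + 1)).
Proof.
  pose proof PI_RGT_0; pose proof (pos_INR m); pose proof (binom_half_pos m) as Hu.
  pose proof (wallis_succ_le (2 * m)) as H1.
  pose proof (wallis_succ_le (2 * m + 1)) as H2.
  replace (S (2 * m)) with (2 * m + 1)%nat in H1 by lia.
  replace (S (2 * m + 1)) with (2 * S m)%nat in H2 by lia.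
  rewrite wallis_odd, wallis_even in H1, H2; simpl binom_half in H2.
  set (u := binom_half m) in *; set (c := INR m) in *.
  assert (Hc : 0 < (2 * c + 1) * u) by nra.
  split.
  - apply (Rmult_le_compat_r (2 / PI * ((2 * c + 1) * u))) in H1;
      [|left; apply Rmult_lt_0_compat; [apply Rdiv_lt_0_compat|]; lra].
    replace (/ ((2 * c + 1) * u) * (2 / PI * ((2 * c + 1) * u))) with (2 / PI) in H1
      by (field; lra).
    replace (u * (PI / 2) * (2 / PI * ((2 * c + 1) * u))) with ((2 * c + 1) * u ^ 2) in H1
      by (field; lra).
    exact H1.
  - apply (Rmult_le_compat_r (2 / PI * (u * (2 * c + 2)))) in H2;
      [|left; apply Rmult_lt_0_compat; [apply Rdiv_lt_0_compat|]; nra].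
    replace (u * ((2 * c + 1) / (2 * c + 2)) * (PI / 2) * (2 / PI * (u * (2 * c + 2))))
      with ((2 * c + 1) * u ^ 2) in H2 by (field; lra).
    replace (/ ((2 * c + 1) * u) * (2 / PI * (u * (2 * c + 2))))
      with (2 / PI * (1 + / (2 * c + 1))) in H2 by (field; lra).
    exact H2.
Qed.

(** * Asymptotics of the expected range *)

Lemma sqr_one_minus_double_bound (alpha : R) :
  0 < alpha < 1 -> 0 <= (1 - 2 * alpha) ^ 2 < 1.
Proof.
  intros Ha; split; [apply pow2_ge_0|].
  replace ((1 - 2 * alpha) ^ 2) with (1 - 4 * (alpha * (1 - alpha))) by ring; nra.
Qed.

Definition sqrt_coef_scaled (q : R) (n : nat) : R := sqrt_coef n * q ^ n.

Lemma sqrt_coef_scaled_abs (q : R) (n : nat) :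
  0 <= q -> Rabs (sqrt_coef_scaled q n) <= q ^ n.
Proof.
  intros Hq; unfold sqrt_coef_scaled; pose proof (pow_le q n Hq).
  rewrite Rabs_mult, (Rabs_pos_eq (q ^ n)) by assumption.
  pose proof (sqrt_coef_abs n); nra.
Qed.

(** The endpoint [x = 1] is allowed because [q < 1]; it yields the sum of all the coefficients. *)
Lemma is_pseries_sqrt_coef_scaled (q x : R) :
  0 <= q < 1 -> 0 <= x <= 1 -> is_pseries (sqrt_coef_scaled q) x (sqrt (1 - q * x)).
Proof.
  intros Hq Hx; pose proof (is_pseries_sqrt_coef (q * x) ltac:(nra)) as H.
  apply is_pseries_R; apply is_pseries_R in H.
  eapply is_series_ext; [|exact H]; intros n; simpl.
  unfold sqrt_coef_scaled; rewrite Rpow_mult_distr; ring.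
Qed.

(** The coefficients of [sqrt (1 - q x) / sqrt (1 - x)]. *)
Definition ratio_coef (q : R) : nat -> R := PS_mult (sqrt_coef_scaled q) binom_half.

Lemma ratio_coef_abs (q : R) (n : nat) :
  0 <= q < 1 -> Rabs (ratio_coef q n) <= / (1 - q).
Proof.
  intros Hq; unfold ratio_coef, PS_mult.
  eapply Rle_trans; [apply Rabs_triang_gen|].
  apply Rle_trans with (sum_f_R0 (fun k => q ^ k) n).
  - apply sum_Rle; intros k _; rewrite Rabs_mult.
    pose proof (sqrt_coef_scaled_abs q k ltac:(lra)).
    pose proof (binom_half_abs (n - k)); pose proof (Rabs_pos (sqrt_coef_scaled q k)).
    pose proof (Rabs_pos (binom_half (n - k))); nra.
  - rewrite tech3 by lra; unfold Rdiv.
    rewrite <- (Rmult_1_l (/ (1 - q))) at 2.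
    apply Rmult_le_compat_r; [left; apply Rinv_0_lt_compat; lra|].
    pose proof (pow_le q (S n) ltac:(lra)); lra.
Qed.

Lemma is_pseries_ratio_coef (q x : R) :
  0 <= q < 1 -> 0 <= x < 1 ->
  is_pseries (ratio_coef q) x (sqrt (1 - q * x) * / sqrt (1 - x)).
Proof.
  intros Hq Hx; assert (Hx' : Rabs x < 1) by (rewrite Rabs_pos_eq; lra).
  assert (He : Rbar_lt (Rabs x) (CV_radius (sqrt_coef_scaled q))).
  { apply (CV_radius_gt_abs _ 1); [|exact Hx'].
    intros n; eapply Rle_trans; [apply sqrt_coef_scaled_abs; lra|].
    rewrite <- (pow1 n); apply pow_incr; lra. }
  assert (Hu : Rbar_lt (Rabs x) (CV_radius binom_half))
    by (apply (CV_radius_gt_abs _ 1); [apply binom_half_abs|exact Hx']).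
  apply is_pseries_mult; try assumption.
  - apply is_pseries_sqrt_coef_scaled; lra.
  - rewrite <- PSeries_binom_half by exact Hx.
    apply PSeries_correct, CV_radius_inside, Hu.
Qed.

(** The even and the odd part both carry the coefficients [a] in the variable [x ^ 2]; the odd part
    has an extra factor [x]. *)
Lemma is_pseries_div2 (a : nat -> R) (x l : R) :
  is_pseries a (x ^ 2) l ->
  is_pseries (fun n => a (Nat.div2 n)) x (l + x * l).
Proof.
  intros H; apply is_pseries_odd_even; (eapply is_pseries_ext; [|exact H]); intros n.
  - now rewrite Nat.div2_double.
  - now rewrite Nat.add_1_r, Nat.div2_succ_double.
Qed.

(* Both sides are the coefficients of
   [((1 + z) sqrt (1 - q z^2) / sqrt (1 - z^2) - 1 - z) / z^2]. *)
Lemma stay_ratio_coef (alpha : R) (n : nat) :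
  0 < alpha < 1 ->
  2 * (1 - alpha) * stay alpha (S n) false 0 =
  ratio_coef ((1 - 2 * alpha) ^ 2) (Nat.div2 (S (S n))).
Proof.
  intros Ha; set (q := (1 - 2 * alpha) ^ 2).
  assert (Hq : 0 <= q < 1) by (apply sqr_one_minus_double_bound, Ha).
  set (b := fun n => stay alpha n false 0).
  set (d := fun n => ratio_coef q (Nat.div2 n)).
  set (X := PS_scal (2 * (1 - alpha)) (PS_decr_1 b)).
  set (Y := PS_decr_1 (PS_decr_1 d)).
  change (X n = Y n).
  (* Multiplying both series by [z ^ 2] avoids a division at [z = 0]. *)
  change (PS_incr_1 (PS_incr_1 X) (S (S n)) = PS_incr_1 (PS_incr_1 Y) (S (S n))).
  assert (Hb : forall x, Rabs x < 1 -> Rbar_lt (Rabs x) (CV_radius b)).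
  { intros x; apply (CV_radius_gt_abs _ 1); intros k; unfold b.
    pose proof (stay_bound alpha k false 0 Ha); rewrite Rabs_pos_eq; lra. }
  assert (Hd : forall x, Rabs x < 1 -> Rbar_lt (Rabs x) (CV_radius d)).
  { intros x; apply (CV_radius_gt_abs _ (/ (1 - q))); intros k; unfold d.
    apply ratio_coef_abs, Hq. }
  assert (H01 : Rabs 0 < 1) by (rewrite Rabs_R0; lra).
  pose proof (Hb 0 H01) as Hb0; pose proof (Hd 0 H01) as Hd0.
  rewrite Rabs_R0 in Hb0, Hd0.
  apply PSeries_ext_recip.
  - rewrite !CV_radius_incr_1; unfold X.
    rewrite CV_radius_scal by lra; rewrite CV_radius_decr_1; exact Hb0.
  - rewrite !CV_radius_incr_1; unfold Y; rewrite !CV_radius_decr_1; exact Hd0.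
  - exists (mkposreal 1 Rlt_0_1); intros z Hz.
    assert (Hz1 : Rabs z < 1).
    { unfold ball in Hz; simpl in Hz; unfold AbsRing_ball, abs, minus, plus, opp in Hz;
        simpl in Hz; rewrite Ropp_0, Rplus_0_r in Hz; exact Hz. }
    assert (Hz' : -1 < z < 1) by (apply Rabs_def2 in Hz1; lra).
    rewrite !PSeries_incr_1; unfold X; rewrite PSeries_scal.
    pose proof (PSeries_decr_1 b z (CV_radius_inside _ _ (Hb z Hz1))) as Eb.
    pose proof (PSeries_decr_1 d z (CV_radius_inside _ _ (Hd z Hz1))) as Ed.
    rewrite (PSeries_decr_1 (PS_decr_1 d) z) in Ed
      by (apply CV_radius_inside; rewrite CV_radius_decr_1; exact (Hd z Hz1)).
    fold Y in Ed.
    replace (b 0%nat) with 1 in Eb by reflexivity.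
    (* [Nat.div2] sends both 0 and 1 to 0, so the first two coefficients of [d] are 1. *)
    replace (d 0%nat) with 1 in Ed
      by (unfold d, ratio_coef, PS_mult, sqrt_coef_scaled; simpl; ring).
    replace (PS_decr_1 d 0%nat) with 1 in Ed
      by (unfold PS_decr_1, d, ratio_coef, PS_mult, sqrt_coef_scaled; simpl; ring).
    assert (Hzz : 0 <= z * z < 1) by nra.
    assert (Hqz : 0 <= q * (z * z) < 1) by nra.
    assert (Hd' : is_pseries d z (sqrt (1 - q * z ^ 2) * / sqrt (1 - z ^ 2)
       + z * (sqrt (1 - q * z ^ 2) * / sqrt (1 - z ^ 2)))).
    { apply is_pseries_div2, is_pseries_ratio_coef; simpl; lra. }
    apply is_pseries_unique in Hd'.
    replace (z ^ 2) with (z * z) in Hd' by ring.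
    assert (HA : 0 < sqrt (1 - z * z)) by (apply sqrt_lt_R0; lra).
    assert (HB : 0 < sqrt (1 - q * (z * z))) by (apply sqrt_lt_R0; lra).
    assert (EA : sqrt (1 - z * z) * sqrt (1 - z * z) = 1 - z * z)
      by (apply sqrt_sqrt; lra).
    assert (EB : sqrt (1 - q * (z * z)) * sqrt (1 - q * (z * z)) = 1 - q * (z * z))
      by (apply sqrt_sqrt; lra).
    pose proof (stay0_gf alpha z _ _ Ha Hz1 HA HB EA EB) as Hb'.
    apply is_pseries_unique in Hb'; fold b in Hb'.
    set (A := sqrt (1 - z * z)) in *; set (B := sqrt (1 - q * (z * z))) in *.
    assert (HAB : 0 < A * B) by nra.
    assert (HD : 0 < 1 + (1 - 2 * alpha) * z * z + A * B) by nra.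
    rewrite Hb' in Eb; rewrite Hd' in Ed.
    transitivity (z * (2 * (1 - alpha) * (z * PSeries (PS_decr_1 b) z))); [ring|].
    transitivity (z * (z * PSeries Y z)); [|ring].
    replace (z * PSeries (PS_decr_1 b) z) with
      ((1 - 2 * z * (1 - alpha) / (1 + (1 - 2 * alpha) * z * z + A * B)) / (1 - z) - 1)
      by lra.
    replace (z * (z * PSeries Y z)) with (B * / A + z * (B * / A) - 1 - z) by lra.
    set (F := 2 * z * (1 - alpha) / _).
    (* Rationalising the denominator: [D] times its conjugate in [A * B] is [4 z^2 (1 - alpha)^2].
       Both sides of the goal then become affine in [A * B]. *)
    assert (EF : 2 * z * (1 - alpha) * F = 1 + (1 - 2 * alpha) * z * z - A * B).
    { assert (EAB : (A * B) * (A * B) = (1 - z * z) * (1 - q * (z * z)))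
        by (rewrite <- EA, <- EB; ring).
      unfold F; set (D := 1 + (1 - 2 * alpha) * z * z + A * B) in *.
      apply (Rmult_eq_reg_r D); [|lra].
      transitivity (4 * z * z * (1 - alpha) * (1 - alpha)); [field; lra|].
      transitivity ((1 + (1 - 2 * alpha) * z * z) ^ 2 - (A * B) * (A * B));
        [rewrite EAB; unfold q|unfold D]; ring. }
    replace (B * / A) with (A * B / (1 - z * z)) by (rewrite <- EA; field; lra).
    transitivity ((2 * z * (1 - alpha) - 2 * z * (1 - alpha) * F) / (1 - z)
                  - 2 * z * (1 - alpha)); [field; lra|].
    rewrite EF; field; split; nra.
Qed.

(** * From coefficient sums to the expected range *)

Lemma sum_div2 (a : nat -> R) (m : nat) :
  sum_f_R0 (fun i => a (Nat.div2 i)) (S (2 * m)) = 2 * sum_f_R0 a m.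
Proof.
  induction m as [|m IH]; [simpl; ring|].
  replace (2 * S m)%nat with (S (S (2 * m))) by lia.
  rewrite tech5, (tech5 _ (S (2 * m))), IH, tech5.
  replace (S (S (2 * m))) with (2 * S m)%nat by lia.
  rewrite Nat.div2_succ_double, Nat.div2_double; ring.
Qed.

(** For odd [n] the two sums agree; for even [n] the last coefficient occurs once instead of
    twice. *)
Lemma sum_div2_approx (a : nat -> R) (K : R) (n : nat) :
  (forall i, Rabs (a i) <= K) ->
  Rabs (sum_f_R0 (fun i => a (Nat.div2 i)) n - 2 * sum_f_R0 a (Nat.div2 n)) <= K.
Proof.
  intros HK.
  destruct (Nat.Even_or_Odd n) as [[m ->]|[m ->]].
  - rewrite Nat.div2_double, <- sum_div2, tech5, Nat.div2_succ_double.
    rewrite <- (Rabs_Ropp); replace (- _) with (a m) by ring; apply HK.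
  - rewrite Nat.add_1_r, Nat.div2_succ_double, sum_div2.
    rewrite Rminus_diag, Rabs_R0; eapply Rle_trans; [apply Rabs_pos|apply (HK O)].
Qed.

(** [stay_ratio_coef] starts at survival index 1, so the sum telescopes from [E Delta_1 = 2]. The
    constant compares [4 (1 - alpha)] with the two initial coefficients 1. *)
Lemma expected_range_sum (alpha : R) (n : nat) :
  0 < alpha < 1 ->
  2 * (1 - alpha) * expected_range alpha (S n) =
  sum_f_R0 (fun i => ratio_coef ((1 - 2 * alpha) ^ 2) (Nat.div2 i)) (S n)
  + (4 * (1 - alpha) - 2).
Proof.
  intros Ha; induction n as [|n IH].
  - rewrite expected_range_succ, expected_range_0.
    unfold ratio_coef, PS_mult, sqrt_coef_scaled; simpl; ring.
  - rewrite expected_range_succ, Rmult_plus_distr_l, IH, (tech5 _ (S n)), stay_ratio_coef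
      by exact Ha.
    ring.
Qed.

Lemma expected_range_approx (alpha : R) :
  0 < alpha < 1 -> exists K, forall n,
  Rabs ((1 - alpha) * expected_range alpha (S n)
        - sum_f_R0 (sqrt_coef_scaled ((1 - 2 * alpha) ^ 2)) (Nat.div2 (S n))
          * sum_f_R0 binom_half (Nat.div2 (S n))) <= K.
Proof.
  intros Ha; set (q := (1 - 2 * alpha) ^ 2).
  assert (Hq : 0 <= q < 1) by (apply sqr_one_minus_double_bound, Ha).
  (* After halving: the parity error, the constant [1 - 2 alpha] of absolute value below 1, and the
     Cauchy product error. *)
  exists (/ 2 * / (1 - q) + 1 + / (1 - q) ^ 2); intros n.
  pose proof (expected_range_sum alpha n Ha) as E; fold q in E.
  pose proof (sum_div2_approx (ratio_coef q) (/ (1 - q)) (S n)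
                (fun i => ratio_coef_abs q i Hq)) as H1.
  pose proof (sum_PS_mult_binom_half q (sqrt_coef_scaled q) (Nat.div2 (S n)) Hq
                (fun j => sqrt_coef_scaled_abs q j (proj1 Hq))) as H2.
  fold (ratio_coef q) in H2.
  apply Rabs_le_between in H1, H2; apply Rabs_le; lra.
Qed.

Lemma div2_bounds (n : nat) :
  INR n <= 2 * INR (Nat.div2 n) + 1 <= INR n + 1.
Proof.
  destruct (Nat.Even_or_Odd n) as [[m ->]|[m ->]].
  - rewrite Nat.div2_double, mult_INR; change (INR 2) with 2; lra.
  - rewrite Nat.add_1_r, Nat.div2_succ_double, S_INR, mult_INR.
    change (INR 2) with 2; lra.
Qed.

Lemma div2_lim (u : nat -> R) (l : Rbar) :
  is_lim_seq u l -> is_lim_seq (fun n => u (Nat.div2 (S n))) l.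
Proof.
  intros H; apply (is_lim_seq_subseq u l (fun n => Nat.div2 (S n))); [|exact H].
  intros P [N HN]; exists (2 * N)%nat; intros n Hn; apply HN.
  rewrite <- (Nat.div2_double N); apply Nat.div2_le_mono; lia.
Qed.

Lemma is_lim_seq_inv_sqrt_S : is_lim_seq (fun n => / sqrt (INR (S n))) 0.
Proof.
  apply (is_lim_seq_ext (fun n => sqrt (/ INR (S n)))).
  { intros n; apply sqrt_inv. }
  rewrite <- sqrt_0; apply is_lim_seq_continuous; [apply continuity_pt_sqrt; lra|].
  apply (is_lim_seq_incr_1 (fun n => / INR n)).
  replace (Finite 0) with (Rbar_inv p_infty) by reflexivity.
  apply is_lim_seq_inv; [apply is_lim_seq_INR|discriminate].
Qed.

Lemma is_lim_seq_sum_binom_half :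
  is_lim_seq (fun n => sum_f_R0 binom_half (Nat.div2 (S n)) / sqrt (INR (S n)))
    (sqrt (2 / PI)).
Proof.
  pose proof PI_RGT_0.
  assert (HP : 0 < 2 / PI) by (apply Rdiv_lt_0_compat; lra).
  (* Everything goes under one root because the Wallis bounds concern the square of [binom_half]. *)
  apply (is_lim_seq_ext (fun n => sqrt (sum_f_R0 binom_half (Nat.div2 (S n)) ^ 2
                                        / INR (S n)))).
  { intros n; pose proof (pos_INR (Nat.div2 (S n))).
    pose proof (binom_half_pos (Nat.div2 (S n))).
    rewrite sqrt_div_alt by (apply lt_0_INR; lia).
    rewrite sqrt_pow2; [reflexivity|rewrite sum_binom_half; nra]. }
  apply is_lim_seq_continuous; [apply continuity_pt_sqrt; lra|].
  (* With [N = INR (S n)], the factor [c = 2 m + 1] lies between [N] and [N + 1], which gives the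
     bounds [2 / PI] and [2 / PI * (N + 2) / N]. *)
  apply (is_lim_seq_le_le (fun _ => 2 / PI) _
           (fun n => 2 / PI * (1 + 2 * (/ sqrt (INR (S n)) * / sqrt (INR (S n)))))).
  - intros n; rewrite sum_binom_half.
    pose proof (div2_bounds (S n)) as Hm.
    pose proof (binom_half_sqr_bounds (Nat.div2 (S n))) as Hu.
    assert (HN : 0 < INR (S n)) by (apply lt_0_INR; lia).
    rewrite <- Rinv_mult, sqrt_sqrt by lra.
    set (c := 2 * INR (Nat.div2 (S n)) + 1) in *; set (u := binom_half _) in *.
    set (N := INR (S n)) in *.
    replace ((c * u) ^ 2 / N) with (c * (c * u ^ 2) / N) by (field; lra).
    replace (2 / PI * (1 + / c)) with (2 / PI * ((c + 1) / c)) in Hu by (field; lra).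
    split.
    + apply (proj1 (Rle_div_r (2 / PI) _ N ltac:(lra))).
      rewrite (Rmult_comm (2 / PI) N); apply Rmult_le_compat; lra.
    + apply (proj2 (Rle_div_l _ _ N ltac:(lra))).
      apply Rle_trans with (c * (2 / PI * ((c + 1) / c)));
        [apply Rmult_le_compat_l; lra|].
      replace (c * (2 / PI * ((c + 1) / c))) with (2 / PI * (c + 1)) by (field; lra).
      replace (2 / PI * (1 + 2 * / N) * N) with (2 / PI * (N + 2)) by (field; lra).
      apply Rmult_le_compat_l; lra.
  - apply is_lim_seq_const.
  - replace (Finite (2 / PI)) with (Finite (2 / PI * (1 + 2 * (0 * 0))))
      by (f_equal; ring).
    pose proof is_lim_seq_inv_sqrt_S as Hi.
    apply is_lim_seq_mult'; [apply is_lim_seq_const|].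
    apply is_lim_seq_plus'; [apply is_lim_seq_const|].
    apply is_lim_seq_mult'; [apply is_lim_seq_const|].
    apply is_lim_seq_mult'; exact Hi.
Qed.

Lemma is_lim_seq_bounded_mult_0 (u v : nat -> R) (K : R) :
  (forall n, Rabs (u n) <= K) -> is_lim_seq v 0 -> is_lim_seq (fun n => u n * v n) 0.
Proof.
  intros HK Hv; apply is_lim_seq_abs_0.
  apply (is_lim_seq_le_le (fun _ => 0) _ (fun n => K * Rabs (v n))).
  - intros n; split; [apply Rabs_pos|].
    rewrite Rabs_mult; apply Rmult_le_compat_r; [apply Rabs_pos|apply HK].
  - apply is_lim_seq_const.
  - replace (Finite 0) with (Finite (K * 0)) by (f_equal; ring).
    apply is_lim_seq_mult'; [apply is_lim_seq_const|].
    apply (proj1 (is_lim_seq_abs_0 v)); exact Hv.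
Qed.

Lemma is_lim_seq_expected_range (alpha : R) :
  0 < alpha < 1 ->
  is_lim_seq (fun n => (1 - alpha) * expected_range alpha (S n) / sqrt (INR (S n)))
    (sqrt (1 - (1 - 2 * alpha) ^ 2) * sqrt (2 / PI)).
Proof.
  intros Ha; set (q := (1 - 2 * alpha) ^ 2).
  assert (Hq : 0 <= q < 1) by (apply sqr_one_minus_double_bound, Ha).
  destruct (expected_range_approx alpha Ha) as [K HK]; fold q in HK.
  set (E := sum_f_R0 (sqrt_coef_scaled q)) in HK.
  set (U := sum_f_R0 binom_half) in HK.
  set (r := fun n => (1 - alpha) * expected_range alpha (S n)
                     - E (Nat.div2 (S n)) * U (Nat.div2 (S n))).
  apply (is_lim_seq_ext (fun n =>
    E (Nat.div2 (S n)) * (U (Nat.div2 (S n)) / sqrt (INR (S n)))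
    + r n * / sqrt (INR (S n)))).
  { intros n; unfold r, Rdiv; ring. }
  rewrite <- (Rplus_0_r (_ * _)).
  apply is_lim_seq_plus'.
  - apply is_lim_seq_mult'; [|exact is_lim_seq_sum_binom_half].
    apply (div2_lim E).
    (* Evaluation at 1 gives [sum_j e_j = sqrt (1 - q)]. *)
    pose proof (is_pseries_sqrt_coef_scaled q 1 Hq ltac:(lra)) as H.
    rewrite Rmult_1_r in H; apply is_pseries_R in H.
    apply (is_lim_seq_ext (sum_n (fun n => sqrt_coef_scaled q n * 1 ^ n))); [|exact H].
    intros n; rewrite sum_n_Reals; apply sum_eq; intros i _; rewrite pow1; ring.
  - apply (is_lim_seq_bounded_mult_0 r _ K HK is_lim_seq_inv_sqrt_S).
Qed.

Theorem theorem3 (alpha : R) (halpha : 0 < alpha < 1) :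
  Un_cv (fun n : nat =>
           expected_range alpha n / sqrt (8 * INR n * alpha / (PI * (1 - alpha)))) 1.
Proof.
  pose proof PI_RGT_0 as HP.
  (* The shift drops the index 0, where the denominator vanishes. *)
  apply is_lim_seq_Reals, is_lim_seq_incr_1.
  set (c := 8 * alpha / (PI * (1 - alpha))).
  assert (Hc : 0 < c) by (apply Rdiv_lt_0_compat; nra).
  assert (Hs : 0 < sqrt c) by (apply sqrt_lt_R0, Hc).
  (* Both sides are [sqrt (8 alpha (1 - alpha) / PI)], since [1 - (1 - 2 alpha)^2 = 4 alpha (1 -
     alpha)]. *)
  assert (EL : sqrt (1 - (1 - 2 * alpha) ^ 2) * sqrt (2 / PI) = (1 - alpha) * sqrt c).
  { rewrite <- sqrt_mult_alt by nra.
    rewrite <- (sqrt_pow2 (1 - alpha)) at 1 by lra.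
    rewrite <- sqrt_mult_alt by nra.
    f_equal; unfold c; field; lra. }
  pose proof (is_lim_seq_expected_range alpha halpha) as H; rewrite EL in H.
  apply (is_lim_seq_ext (fun n =>
    (1 - alpha) * expected_range alpha (S n) / sqrt (INR (S n))
    / ((1 - alpha) * sqrt c))).
  { intros n; assert (HN : 0 < INR (S n)) by (apply lt_0_INR; lia).
    replace (8 * INR (S n) * alpha / (PI * (1 - alpha))) with (INR (S n) * c)
      by (unfold c; field; lra).
    rewrite sqrt_mult_alt by lra.
    assert (0 < sqrt (INR (S n))) by (apply sqrt_lt_R0, HN).
    field; repeat split; lra. }
  replace (Finite 1) with (Finite ((1 - alpha) * sqrt c / ((1 - alpha) * sqrt c)))
    by (f_equal; field; lra).
  apply is_lim_seq_div'; [exact H|apply is_lim_seq_const|nra].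
Qed.
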